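(* Let $d\ge 2$ be an integer, $p$ a prime with $p\equiv 1\pmod d$, $t=\frac{p-1}{d}$, and $T$ a generator of $\widehat{\mathbb F_p^{\times}}$. Then for every integer $x$ with $p\nmid x$, $$p^{d-2}\,{}_{d-1}F_{d-2}\left(\left.\begin{array}{cccc}T^{t}&T^{2t}&\ldots&T^{(d-1)t}\\ {}&\epsilon&\ldots&\epsilon\end{array}\right|x\right)_p\equiv(-1)^d\,{}_{d-1}F_{d-2}\left(\left.\begin{array}{cccc}\tfrac{1}{d}&\tfrac{2}{d}&\ldots&\tfrac{d-1}{d}\\ {}&1&\ldots&1\end{array}\right|x\right)_{\mathrm{tr}(p)}\pmod p.$$
   Context: Characters are regarded as $\mathbb Z_p$-valued (their values are $(p-1)$-th roots of unity, which lie in $\mathbb Z_p$) and extended by $\chi(0)=0$; $\epsilon$ is the trivial character; the congruence means the difference lies in $p\mathbb Z_p$, with $x$ reduced mod $p$ on the left. For characters $A,B$ of $\mathbb F_p^\times$, $\binom{A}{B}:=\frac{B(-1)}{p}\sum_{y\in\mathbb F_p}A(y)\overline B(1-y)$, and Greene's function is ${}_{n+1}F_n\left(\left.\begin{array}{ccc}A_0&\ldots&A_n\\ &B_1\ldots&B_n\end{array}\right|x\right)_p:=\frac{p}{p-1}\sum_\chi\binom{A_0\chi}{\chi}\prod_{i=1}^n\binom{A_i\chi}{B_i\chi}\chi(x)$, summed over all characters $\chi$. The truncated classical series is ${}_{n+1}F_n\left(\left.\begin{array}{ccc}a_0&\ldots&a_n\\ &b_1\ldots&b_n\end{array}\right|x\right)_{\mathrm{tr}(m)}:=\sum_{k=0}^{m-1}\frac{(a_0)_k\cdots(a_n)_k}{(b_1)_k\cdots(b_n)_k\,k!}x^k$,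 where $(a)_0=1$, $(a)_k=a(a+1)\cdots(a+k-1)$. *)

(* Defs.v *)
From HB Require Import structures.
From Stdlib Require Import Classical ClassicalEpsilon FunctionalExtensionality ProofIrrelevance.
From mathcomp Require Import all_boot all_algebra.
Set Implicit Arguments. Unset Strict Implicit. Unset Printing Implicit Defensive.
Import GRing.Theory Num.Theory.
Local Open Scope ring_scope.

Section PadicIntegers.
Variable p : nat.

(* the prime used: equal to p whenever p is prime *)
Definition zp_prime : nat := pdiv (maxn p 2).
Definition zp_mod (n : nat) : int := (zp_prime ^ n)%N%:Z.

Definition zp_coherent (f : nat -> int) : Prop :=
  forall n, (f n %% zp_mod n)%Z = f n /\ (f n.+1 %% zp_mod n)%Z = f n.

Definition Zp_type := {f : nat -> int | zp_coherent f}.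

Lemma zp_prime_prime : prime zp_prime.
Proof. by apply: pdiv_prime; rewrite leq_max leqnn orbT. Qed.

Lemma zp_mod_neq0 n : zp_mod n != 0.
Proof.
by rewrite /zp_mod -lt0n expn_gt0 prime_gt0 // zp_prime_prime.
Qed.

Lemma zp_ext (x y : Zp_type) : (forall n, sval x n = sval y n) -> x = y.
Proof.
case: x y => [f hf] [g hg] /= e.
have efg : f = g by apply: functional_extensionality.
subst g; by rewrite (proof_irrelevance _ hf hg).
Qed.

Definition zp_eqb (x y : Zp_type) : bool :=
  if excluded_middle_informative (x = y) then true else false.
Lemma zp_eqP : Equality.axiom zp_eqb.
Proof. by move=> x y; rewrite /zp_eqb; case: excluded_middle_informative => h; constructor. Qed.
HB.instance Definition _ := hasDecEq.Build Zp_type zp_eqP.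

Definition zp_find (P : pred Zp_type) (n : nat) : option Zp_type :=
  match excluded_middle_informative (exists x, P x) with
  | left h => Some (proj1_sig (constructive_indefinite_description _ h))
  | right _ => None
  end.
Lemma zp_find_correct P n x : zp_find P n = Some x -> P x.
Proof.
rewrite /zp_find; case: excluded_middle_informative => // h [<-].
exact: proj2_sig (constructive_indefinite_description _ h).
Qed.
Lemma zp_find_complete (P : pred Zp_type) : (exists x, P x) -> exists n, zp_find P n.
Proof. by move=> h; exists 0%N; rewrite /zp_find; case: excluded_middle_informative. Qed.
Lemma zp_find_ext (P Q : pred Zp_type) : P =1 Q -> zp_find P =1 zp_find Q.
Proof. by move=> e; have -> : P = Q by apply: functional_extensionality. Qed.
HB.instance Definition _ := hasChoice.Build Zp_type zp_find_correct zp_find_complete zp_find_ext.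

Lemma zp_mod_dvd n k : (zp_mod n %| zp_mod (n + k))%Z.
Proof. rewrite /zp_mod expnD; exact: dvdn_mulr. Qed.

Lemma modz_dvd_mod (m d e : int) : (e %| d)%Z -> (((m %% d)%Z %% e)%Z = (m %% e)%Z).
Proof.
move=> ed; apply/eqP; rewrite eqz_mod_dvd.
have -> : (m %% d)%Z - m = - ((m %/ d)%Z * d) by rewrite {2}(divz_eq m d) opprD addrCA subrr addr0.
by rewrite -mulNr dvdz_mull.
Qed.

Lemma zp_coh_iter (f : Zp_type) n k : ((sval f (n + k)%N) %% zp_mod n)%Z = sval f n.
Proof.
elim: k => [|k IH]; first by rewrite addn0 (proj1 (proj2_sig f n)).
rewrite addnS -(modz_dvd_mod _ (zp_mod_dvd n k)) (proj2 (proj2_sig f (n + k))) //.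
Qed.

Lemma zp_mkP (g : nat -> int) : (forall n, (g n.+1 %% zp_mod n)%Z = (g n %% zp_mod n)%Z) ->
  zp_coherent (fun n => (g n %% zp_mod n)%Z).
Proof.
move=> hg n; split; first by rewrite modz_mod.
by rewrite -[n.+1]addn1 (modz_dvd_mod _ (zp_mod_dvd n 1)) addn1 hg.
Qed.

Definition zp_mk (g : nat -> int) (hg : forall n, (g n.+1 %% zp_mod n)%Z = (g n %% zp_mod n)%Z) : Zp_type :=
  exist _ _ (zp_mkP hg).


Lemma zp_comp_mod (x : Zp_type) n : ((sval x n) %% zp_mod n)%Z = (sval x n).
Proof. exact: proj1 (proj2_sig x n). Qed.
Lemma zp_comp_succ (x : Zp_type) (n : nat) : ((sval x n.+1) %% zp_mod n)%Z = (sval x n).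
Proof. exact: proj2 (proj2_sig x n). Qed.

Lemma zp_zero_h n : ((0:int) %% zp_mod n)%Z = ((0:int) %% zp_mod n)%Z. Proof. by []. Qed.
Definition zp_zero := @zp_mk (fun _ => 0) zp_zero_h.
Lemma zp_one_h n : ((1:int) %% zp_mod n)%Z = ((1:int) %% zp_mod n)%Z. Proof. by []. Qed.
Definition zp_one := @zp_mk (fun _ => 1) zp_one_h.

Lemma zp_add_h (x y : Zp_type) n :
  (((sval x n.+1) + (sval y n.+1)) %% zp_mod n)%Z = (((sval x n) + (sval y n)) %% zp_mod n)%Z.
Proof. by rewrite -modzDm !zp_comp_succ. Qed.
Definition zp_add x y := @zp_mk (fun n => sval x n + sval y n) (zp_add_h x y).
Lemma zp_opp_h (x : Zp_type) n :
  ((- (sval x n.+1)) %% zp_mod n)%Z = ((- (sval x n)) %% zp_mod n)%Z.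
Proof. by rewrite -modzNm zp_comp_succ. Qed.
Definition zp_opp x := @zp_mk (fun n => - sval x n) (zp_opp_h x).
Lemma zp_mul_h (x y : Zp_type) n :
  (((sval x n.+1) * (sval y n.+1)) %% zp_mod n)%Z = (((sval x n) * (sval y n)) %% zp_mod n)%Z.
Proof. by rewrite -modzMm !zp_comp_succ. Qed.
Definition zp_mul x y := @zp_mk (fun n => sval x n * sval y n) (zp_mul_h x y).

Lemma zp_addA : associative zp_add.
Proof. by move=> x y z; apply: zp_ext => n /=; rewrite modzDml modzDmr addrA. Qed.
Lemma zp_addC : commutative zp_add.
Proof. by move=> x y; apply: zp_ext => n /=; rewrite addrC. Qed.
Lemma zp_add0 : left_id zp_zero zp_add.
Proof. by move=> x; apply: zp_ext => n /=; rewrite mod0z add0r zp_comp_mod. Qed.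
Lemma zp_addN : left_inverse zp_zero zp_opp zp_add.
Proof. by move=> x; apply: zp_ext => n /=; rewrite modzDml addNr. Qed.
HB.instance Definition _ := GRing.isZmodule.Build Zp_type zp_addA zp_addC zp_add0 zp_addN.

Lemma zp_mulA : associative zp_mul.
Proof. by move=> x y z; apply: zp_ext => n /=; rewrite modzMml modzMmr mulrA. Qed.
Lemma zp_mulC : commutative zp_mul.
Proof. by move=> x y; apply: zp_ext => n /=; rewrite mulrC. Qed.
Lemma zp_mul1 : left_id zp_one zp_mul.
Proof. by move=> x; apply: zp_ext => n /=; rewrite modzMml mul1r zp_comp_mod. Qed.
Lemma zp_mulDl : left_distributive zp_mul (+%R : Zp_type -> _ -> _).
Proof.
move=> x y z; apply: zp_ext => n /=.
by rewrite modzMml modzDm mulrDl.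
Qed.
Lemma zp_one_neq0 : zp_one != 0.
Proof.
apply/eqP => /(congr1 (fun x : Zp_type => (sval x 1))) /=.
rewrite mod0z modz_small //; rewrite /zp_mod expn1 ler01 /= ltz_nat.
by rewrite prime_gt1 // zp_prime_prime.
Qed.
HB.instance Definition _ := GRing.Zmodule_isComNzRing.Build Zp_type zp_mulA zp_mulC zp_mul1 zp_mulDl zp_one_neq0.

Definition zp_unit : {pred Zp_type} := fun x =>
  if excluded_middle_informative (exists y : Zp_type, y * x = 1) then true else false.
Definition zp_inv (x : Zp_type) : Zp_type :=
  match excluded_middle_informative (exists y : Zp_type, y * x = 1) with
  | left h => proj1_sig (constructive_indefinite_description _ h)
  | right _ => x
  end.
Lemma zp_unitE x : (x \in zp_unit) = (if excluded_middle_informative (exists y : Zp_type, y * x = 1) then true else false).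
Proof. by []. Qed.
Lemma zp_mulVx : {in zp_unit, left_inverse 1 zp_inv *%R}.
Proof.
move=> x; rewrite zp_unitE /zp_inv; case: excluded_middle_informative => // h _.
exact: proj2_sig (constructive_indefinite_description _ h).
Qed.
Lemma zp_unitPl (x y : Zp_type) : y * x = 1 -> x \in zp_unit.
Proof. by move=> h; rewrite zp_unitE; case: excluded_middle_informative => // -[]; exists y. Qed.
Lemma zp_inv_out : {in [predC zp_unit], zp_inv =1 id}.
Proof.
move=> x; rewrite inE /= zp_unitE /zp_inv; case: excluded_middle_informative => //.
Qed.
HB.instance Definition _ := GRing.ComNzRing_hasMulInverse.Build Zp_type zp_mulVx zp_unitPl zp_inv_out.

Lemma zp_comp_ge0 (x : Zp_type) n : 0 <= (sval x n).
Proof. by rewrite -zp_comp_mod modz_ge0 // zp_mod_neq0. Qed.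

Lemma zp_nz_idx (x : Zp_type) : x != 0 -> exists N, ~~ (zp_mod N %| (sval x N))%Z.
Proof.
move=> nx; apply: NNPP => h; move/eqP: nx; apply; apply: zp_ext => n.
case hd: (zp_mod n %| sval x n)%Z; last by exfalso; apply: h; exists n; rewrite hd.
change (sval x n = ((0:int) %% zp_mod n)%Z).
by rewrite mod0z -zp_comp_mod; apply/dvdz_mod0P.
Qed.

Lemma zp_nz_big (x : Zp_type) N k : ~~ (zp_mod N %| (sval x N))%Z -> ~~ (zp_mod N %| (sval x (N + k)%N))%Z.
Proof.
apply: contra => /dvdz_mod0P d; apply/dvdz_mod0P.
by rewrite -(zp_coh_iter x N k) modz_mod d.
Qed.

Lemma zp_mulf_eq0 : GRing.integral_domain_axiom Zp_type.
Proof.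
move=> x y xy0; apply/norP => -[nx ny].
have [N1 h1] := zp_nz_idx nx; have [N2 h2] := zp_nz_idx ny.
have ha := zp_nz_big N2 h1.
have hb := zp_nz_big N1 h2; rewrite addnC in hb.
have hxy : (zp_mod (N1 + N2) %| sval x (N1 + N2)%N * sval y (N1 + N2)%N)%Z.
  apply/dvdz_mod0P; have := congr1 (fun z : Zp_type => sval z (N1 + N2)%N) xy0.
  by rewrite [RHS]/= mod0z.
move: ha hb hxy; rewrite /zp_mod -!topredE /= /dvdz abszM !absz_nat.
set a := `|sval x (N1 + N2)%N|%N; set b := `|sval y (N1 + N2)%N|%N.
move=> ha hb hab.
have pq := zp_prime_prime.
have a0 : (0 < a)%N by rewrite lt0n; apply: contraNneq ha => ->; rewrite dvdn0.
have b0 : (0 < b)%N by rewrite lt0n; apply: contraNneq hb => ->; rewrite dvdn0.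
move: ha hb hab; rewrite !pfactor_dvdn ?muln_gt0 ?a0 ?b0 // lognM // -!ltnNge => ha hb.
by rewrite leqNgt (leq_trans _ (leq_add ha hb)) // addSn ltnS leq_add2l leqnSn.
Qed.
HB.instance Definition _ := GRing.ComUnitRing_isIntegral.Build Zp_type zp_mulf_eq0.

End PadicIntegers.

(* The p-adic integers Z_p (as coherent sequences of residues mod p^n; for   *)
(* p prime, zp_prime = p) and the p-adic numbers Q_p = Frac(Z_p).            *)
Notation Zpadic p := (Zp_type p).
Notation Qpadic p := {fraction Zp_type p}.
Definition zp_to_qp (p : nat) (z : Zpadic p) : Qpadic p := @FracField.tofrac (Zpadic p) z.

Definition congp (p : nat) (a b : Qpadic p) : Prop :=
  exists z : Zpadic p, a - b = (p%:R : Qpadic p) * zp_to_qp z.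

(* Z_p-valued (multiplicative) characters of F_p^x, extended by chi(0) = 0. *)
Definition pchar (p : nat) := {ffun 'F_p -> Zpadic p}.

Definition is_character (p : nat) (chi : pchar p) : Prop :=
  [/\ chi 0 = 0, chi 1 = 1 & forall a b : 'F_p, chi (a * b) = chi a * chi b].

Definition eps_char (p : nat) : pchar p := [ffun y : 'F_p => if y == 0 then 0 else 1].

Definition char_pow (p : nat) (T : pchar p) (k : nat) : pchar p :=
  [ffun y : 'F_p => if y == 0 then 0 else T y ^+ k].

Definition char_mul (p : nat) (A B : pchar p) : pchar p := [ffun y : 'F_p => A y * B y].

Definition is_char_generator (p : nat) (T : pchar p) : Prop :=
  is_character T /\ forall chi : pchar p, is_character chi -> exists k : nat, chi = char_pow T k.

(* a duplicate-free enumeration of all characters (chosen classically; any   *)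
(* two such enumerations are permutations of each other)                     *)
Definition all_chars (p : nat) : seq (pchar p) :=
  match excluded_middle_informative
          (exists s : seq (pchar p), uniq s /\ forall chi, is_character chi <-> chi \in s) with
  | left h => proj1_sig (constructive_indefinite_description _ h)
  | right _ => [::]
  end.

Definition cval (p : nat) (chi : pchar p) (y : 'F_p) : Qpadic p := zp_to_qp (chi y).

(* Greene's binomial coefficient  (A choose B) = B(-1)/p sum_y A(y) Bbar(1-y), *)
(* where Bbar = B^{-1} is the inverse character (Bbar(0) = 0).                *)
Definition gbinom (p : nat) (A B : pchar p) : Qpadic p :=
  cval B (-1) / (p%:R) * \sum_(y : 'F_p) cval A y * (cval B (1 - y))^-1.

Definition greeneF (p : nat) (n : nat) (A B : nat -> pchar p) (x : 'F_p) : Qpadic p :=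
  (p%:R / (p%:R - 1)) *
  \sum_(chi <- all_chars p)
     (gbinom (char_mul (A 0%N) chi) chi *
      \prod_(1 <= i < n.+1) gbinom (char_mul (A i) chi) (char_mul (B i) chi) *
      cval chi x).

Definition poch (F : fieldType) (a : F) (k : nat) : F := \prod_(j < k) (a + j%:R).

Definition truncF (F : fieldType) (n : nat) (a b : nat -> F) (x : F) (m : nat) : F :=
  \sum_(k < m)
    (\prod_(0 <= i < n.+1) poch (a i) k) /
    ((\prod_(1 <= i < n.+1) poch (b i) k) * (k`!)%:R) * x ^+ k.

(* Main.v *)
Require Import Defs.
From HB Require Import structures.
From Stdlib Require Import ClassicalEpsilon.
From mathcomp Require Import all_boot all_algebra finfield zify ring.
Set Implicit Arguments. Unset Strict Implicit. Unset Printing Implicit Defensive.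
Import GRing.Theory Num.Theory.
Local Open Scope ring_scope.

(** Let [w] be the Teichmueller character, which reduces to the identity mod [p].
    A generator [T] is [w^m] with [m] prime to [p - 1], and the characters are the
    [w^k] with [k < p - 1]. The powers of [p] cancel, and what remains is
    [1/(p-1)] times a sum over [k] of products of Jacobi sums. With
    [e = m i mod d], such a sum reduces to
    [(-1)^k sum_y y^(et+k) (1-y)^(p-1-k)], which the power sums over [F_p] collapse
    to [- C(et+k, k) = - (et+1)_k / k!]. Since [dt = -1] in [F_p], [et + 1 = (d-e)/d],
    and [i |-> d - e] permutes [1, .., d-1], so the [k]-th term is, up to sign, the
    [k]-th term of the truncated series. The remaining term [k = p - 1] of that series
    vanishes mod [p]. *)

(** * Power sums over ['F_p] *)

Lemma Fp_natr_eq0 (p n : nat) : prime p -> (n%:R == 0 :> 'F_p) = (p %| n)%N.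
Proof. by move=> hp; rewrite -(dvdn_pcharf (pchar_Fp hp)). Qed.

Lemma Fp_natr_neq0 (p n : nat) : prime p -> (0 < n < p)%N -> n%:R != 0 :> 'F_p.
Proof. by move=> hp /andP[n0 np]; rewrite Fp_natr_eq0 // gtnNdvd. Qed.

Lemma Fp_pred_natr (p : nat) : prime p -> p.-1%:R = -1 :> 'F_p.
Proof.
move=> hp; apply/eqP; rewrite -subr_eq0 opprK natr1 prednK ?prime_gt0 //.
by rewrite Fp_natr_eq0.
Qed.

Lemma Fp_fact_neq0 (p k : nat) : prime p -> (k < p)%N -> k`!%:R != 0 :> 'F_p.
Proof.
move=> hp; elim: k => [|k IH] kp; first by rewrite oner_eq0.
by rewrite factS natrM mulf_neq0 ?IH ?Fp_natr_neq0 // ltnW.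
Qed.

Lemma Fp_expf_pred (p : nat) (x : 'F_p) : prime p -> x != 0 -> x ^+ p.-1 = 1.
Proof.
move=> hp x0; apply: (mulfI x0); rewrite -exprS prednK ?prime_gt0 // mulr1.
by have := expf_card x; rewrite card_Fp.
Qed.

Lemma Fp_poly_eq0 (p : nat) (q : {poly 'F_p}) : prime p -> (size q <= p.-1)%N ->
  (forall x, x != 0 -> q.[x] = 0) -> q = 0.
Proof.
move=> hp sq q0; apply/eqP; apply: contraLR sq => nq; rewrite -ltnNge.
have <- : size (enum [pred x : 'F_p | x != 0]) = p.-1.
  by rewrite -cardE; have := cardC1 (0 : 'F_p); rewrite card_Fp.
apply: max_poly_roots => //; last exact: enum_uniq.
by apply/allP => x; rewrite mem_enum inE => x0; apply/eqP/q0.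
Qed.

(** The difference [X^k - X^l] has degree below [p - 1] and vanishes at every unit. In what follows
    this does the work of a primitive root. *)
Lemma Fp_expr_inj (p k l : nat) : prime p -> (k < p.-1)%N -> (l < p.-1)%N ->
  (forall x : 'F_p, x != 0 -> x ^+ k = x ^+ l) -> k = l.
Proof.
move=> hp kp lp h.
have /eqP : 'X^k - 'X^l = 0 :> {poly 'F_p}.
  apply: Fp_poly_eq0 => // [|x x0].
    by rewrite (leq_trans (size_polyD _ _)) // size_polyN !size_polyXn geq_max kp.
  by rewrite !hornerE h // subrr.
rewrite subr_eq0 => /eqP /(congr1 (fun q : {poly 'F_p} => size q)).
by rewrite !size_polyXn => -[].
Qed.

(** If [p - 1] does not divide [n], some unit [g] has [g ^ n != 1], and substituting [g * y] for [y]
    multiplies the sum by [g ^ n]. The bounds leave [p - 1] as the only multiple. *)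
Lemma Fp_sum_expr (p n : nat) : prime p -> (0 < n < p.-1.*2)%N ->
  \sum_(y : 'F_p) y ^+ n = - (n == p.-1)%:R.
Proof.
move=> hp /andP[n0 n2].
case: eqP => [->|/eqP np].
  rewrite (bigD1 (0 : 'F_p)) //= expr0n.
  have p1 : (0 < p.-1)%N by rewrite -subn1 subn_gt0 prime_gt1.
  rewrite (gtn_eqF p1) add0r (eq_bigr (fun=> 1)); last by move=> y; exact: Fp_expf_pred.
  by rewrite sumr_const cardC1 card_Fp // Fp_pred_natr.
have [g g0 gn] : exists2 g : 'F_p, g != 0 & g ^+ n != 1.
  pose r := (n %% p.-1)%N.
  have p1 : (0 < p.-1)%N by rewrite -subn1 subn_gt0 prime_gt1.
  have r0 : (0 < r)%N.
    rewrite lt0n; apply: contra np => /dvdnP[q eq]; move: n0 n2; rewrite eq.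
    case: q {eq} => [|[|q]] //; first by rewrite mul1n.
    by rewrite -mul2n ltn_pmul2r.
  (* Without such a [g], [x ^ r] and [x ^ 0] would agree at all units, forcing [r = 0]. *)
  case: (pickP [pred g : 'F_p | (g != 0) && (g ^+ n != 1)]) => [g /andP[g0 gn]|h].
    by exists g.
  suff: r = 0%N by move=> e; rewrite e in r0.
  apply: (@Fp_expr_inj p) => // [|x x0]; first by rewrite ltn_mod.
  have := h x; rewrite /= x0 /= => /negbFE /eqP.
  by rewrite {1}(divn_eq n p.-1) exprD mulnC exprM Fp_expf_pred // expr1n mul1r.
have e : \sum_(y : 'F_p) y ^+ n = g ^+ n * \sum_(y : 'F_p) y ^+ n.
  rewrite mulr_sumr (reindex_inj (mulfI g0)) /=.
  by apply: eq_bigr => y _; rewrite exprMn.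
rewrite oppr0; apply/eqP; move/eqP: e; rewrite -subr_eq0 -{1}[X in X - _]mul1r -mulrBl mulf_eq0.
by rewrite subr_eq0 eq_sym (negbTE gn).
Qed.

(** * Binomial coefficients and Pochhammer symbols mod [p] *)

(** Since [p] divides ['C(p, s.+1)], Pascal's rule makes neighbouring entries of row [p - 1]
    opposite. *)
Lemma Fp_bin_pred (p s : nat) : prime p -> (s < p)%N -> 'C(p.-1, s)%:R = (-1) ^+ s :> 'F_p.
Proof.
move=> hp; elim: s => [|s IH] sp; first by rewrite bin0.
have: ('C(p, s.+1))%:R == 0 :> 'F_p by rewrite Fp_natr_eq0 // prime_dvd_bin.
have -> : 'C(p, s.+1) = ('C(p.-1, s.+1) + 'C(p.-1, s))%N.
  by rewrite -binS prednK ?prime_gt0.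
rewrite natrD IH ?(ltnW sp) // addr_eq0 => /eqP ->.
by rewrite exprS mulN1r.
Qed.

Lemma poch_recr (F : fieldType) (a : F) k : poch a k.+1 = poch a k * (a + k%:R).
Proof. by rewrite /poch big_ord_recr. Qed.

Lemma poch1 (F : fieldType) k : poch (1 : F) k = k`!%:R.
Proof.
elim: k => [|k IH]; first by rewrite /poch big_ord0.
by rewrite poch_recr IH nat1r -natrM mulnC -factS.
Qed.

(** Going down from row [p - 1 - k] multiplies the entry by [(p-1-k-s)/(p-1-k)], which is
    [(s+1+k)/(k+1)] mod [p], the ratio of consecutive Pochhammer quotients. *)
Lemma Fp_bin_poch (p s k : nat) : prime p -> (s < p)%N -> (k < p)%N ->
  'C(p.-1 - k, s)%:R = (-1) ^+ s * (poch s.+1%:R k / k`!%:R) :> 'F_p.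
Proof.
move=> hp sp; elim: k => [|k IH] kp.
  by rewrite subn0 /poch big_ord0 fact0 divr1 mulr1 Fp_bin_pred.
have k1 : k.+1%:R != 0 :> 'F_p by rewrite Fp_natr_neq0.
have eN : (p.-1 - k)%:R = - k.+1%:R :> 'F_p.
  have kp' : (k <= p.-1)%N by rewrite -ltnS prednK ?prime_gt0 // ltnW.
  by rewrite natrB // Fp_pred_natr // -opprD nat1r.
apply: (mulfI k1); apply: oppr_inj; rewrite -mulNr -eN subnS -natrM mul_bin_down natrM.
have -> : (p.-1 - k - s)%:R * 'C(p.-1 - k, s)%:R =
          - (k.+1%:R + s%:R) * 'C(p.-1 - k, s)%:R :> 'F_p.
  (* For [s > p - 1 - k] the truncated difference is wrong in ['F_p], but then the binomial
     coefficient is zero. *)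
  case: (leqP s (p.-1 - k)) => h; first by rewrite natrB // eN opprD.
  by rewrite bin_small // !mulr0.
rewrite mulNr; congr (- _); rewrite IH ?(ltnW kp) // poch_recr factS natrM.
have -> : k.+1%:R + s%:R = s.+1%:R + k%:R :> 'F_p by rewrite -!natrD addSnnS addnC.
rewrite invfM; move: (s.+1%:R + _) (k.+1%:R) k1 (@Fp_fact_neq0 _ _ hp (ltnW kp)) => a b b0.
move: (k`!%:R) => c c0.
by field; apply/andP; split.
Qed.

(* Expanding [(1 - y)^(p-1-k)], only the exponent [p-1] contributes to the sum over [y]. *)
Lemma Fp_jacobi_sum (p s k : nat) : prime p -> odd p -> (0 < s < p.-1)%N -> (k < p.-1)%N ->
  (-1) ^+ k * \sum_(y : 'F_p) y ^+ (s + k) * (1 - y) ^+ (p.-1 - k) =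
  - (poch s.+1%:R k / k`!%:R).
Proof.
move=> hp op /andP[s0 sp] kp.
have pp : (p.-1 < p)%N by rewrite prednK ?prime_gt0.
have even_p : ~~ odd p.-1 by move: op; rewrite -{1}(prednK (prime_gt0 hp)) oddS.
set N := (p.-1 - k)%N.
have eNk : (N + k = p.-1)%N by rewrite subnK // ltnW.
have -> : \sum_(y : 'F_p) y ^+ (s + k) * (1 - y) ^+ N =
    \sum_(j < N.+1) (-1) ^+ j * 'C(N, j)%:R * - (s + k + j == p.-1)%N%:R.
  transitivity (\sum_(y : 'F_p) \sum_(j < N.+1) (-1) ^+ j * 'C(N, j)%:R * y ^+ (s + k + j)).
    apply: eq_bigr => y _; rewrite exprBn mulr_sumr; apply: eq_bigr => j _.
    by rewrite expr1n mulr1 -[in LHS]mulr_natr [in RHS]exprD; ring.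
  rewrite exchange_big; apply: eq_bigr => j _; rewrite -mulr_sumr Fp_sum_expr //.
  (* The exponent is at least [s > 0] and at most [s + (p - 1) < 2(p - 1)]. *)
  by have := ltn_ord j; lia.
have key : \sum_(j < N.+1) (-1) ^+ j * 'C(N, j)%:R * - (s + k + j == p.-1)%N%:R
    = - ((-1) ^+ (N - s) * 'C(N, s)%:R) :> 'F_p.
  (* The surviving index is [j = N - s]; if [s > N] there is none, and ['C(N, s) = 0]. *)
  case: (leqP s N) => sN.
    have lt : (N - s < N.+1)%N by rewrite ltnS leq_subr.
    rewrite (bigD1 (Ordinal lt)) //= big1 => [|j nj].
      rewrite addr0 bin_sub // -eNk addnAC subnKC // eqxx.
      by rewrite mulrN mulr1.
    rewrite -eNk addnAC eqn_add2r.
    case: eqP => [e|_]; last by rewrite oppr0 mulr0.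
    by case/negP: nj; apply/eqP/val_inj; rewrite /=; lia.
  rewrite big1 => [|j _]; first by rewrite bin_small // mulr0 oppr0.
  rewrite gtn_eqF ?oppr0 ?mulr0 // -eNk.
  by rewrite ltn_addr // ltn_add2r.
rewrite key mulrN; congr (- _).
case: (leqP s N) => sN; last first.
  have := @Fp_bin_poch p s k hp (ltn_trans sp pp) (ltn_trans kp pp).
  rewrite bin_small // => /eqP; rewrite eq_sym mulf_eq0 signr_eq0 => /eqP ->.
  by rewrite !mulr0.
rewrite Fp_bin_poch ?(ltn_trans _ pp) // !mulrA -exprD -exprD.
(* The signs combine to [(-1) ^ (p - 1) = 1], as [p] is odd. *)
have -> : (k + (N - s) + s)%N = p.-1 by lia.
by rewrite -signr_odd (negbTE even_p) mul1r.
Qed.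

(** * Reduction of [p]-adic integers mod [p] *)

Lemma zp_prime_id (p : nat) : prime p -> zp_prime p = p.
Proof.
move=> hp; have /maxn_idPl e := prime_gt1 hp.
by rewrite /zp_prime e pdiv_id.
Qed.

Lemma zp_mod1 (p : nat) : prime p -> zp_mod p 1 = p%:Z.
Proof. by move=> hp; rewrite /zp_mod zp_prime_id // expn1. Qed.

Lemma zp_modS (p n : nat) : prime p -> zp_mod p n.+1 = p%:Z * zp_mod p n.
Proof. by move=> hp; rewrite /zp_mod zp_prime_id // expnS PoszM. Qed.

Lemma Fp_intr_mod (p : nat) (a : int) : prime p -> (a %% p)%Z%:~R = a%:~R :> 'F_p.
Proof.
move=> hp; apply/eqP; rewrite -subr_eq0 -intrB -(dvdz_pcharf (pchar_Fp hp)).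
by rewrite -eqz_mod_dvd modz_mod.
Qed.

Lemma Fp_intr_eq0 (p : nat) (a : int) : prime p -> (a%:~R == 0 :> 'F_p) = (p%:Z %| a)%Z.
Proof. by move=> hp; rewrite -(dvdz_pcharf (pchar_Fp hp)). Qed.

(** Component [n] is a residue mod [p ^ n], so index 1 holds the residue mod [p]. *)
Definition zred (p : nat) (z : Zpadic p) : 'F_p := (sval z 1%N)%:~R.

Lemma zredD (p : nat) (hp : prime p) (a b : Zpadic p) : zred (a + b) = zred a + zred b.
Proof. by rewrite /zred [sval (a + b) 1%N]/= zp_mod1 // Fp_intr_mod // intrD. Qed.

Lemma zredN (p : nat) (hp : prime p) (a : Zpadic p) : zred (- a) = - zred a.
Proof. by rewrite /zred [sval (- a) 1%N]/= zp_mod1 // Fp_intr_mod // mulrNz. Qed.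

Lemma zredM (p : nat) (hp : prime p) (a b : Zpadic p) : zred (a * b) = zred a * zred b.
Proof. by rewrite /zred [sval (a * b) 1%N]/= zp_mod1 // Fp_intr_mod // intrM. Qed.

Lemma zred0 (p : nat) : zred (0 : Zpadic p) = 0.
Proof. by rewrite /zred [sval (0 : Zpadic p) 1%N]/= mod0z. Qed.

Lemma zred1 (p : nat) (hp : prime p) : zred (1 : Zpadic p) = 1.
Proof. by rewrite /zred [sval (1 : Zpadic p) 1%N]/= zp_mod1 // Fp_intr_mod. Qed.

Lemma zredX (p : nat) (hp : prime p) (a : Zpadic p) n : zred (a ^+ n) = zred a ^+ n.
Proof. by elim: n => [|n IH]; rewrite ?zred1 // !exprS zredM // IH. Qed.

Lemma sval_zp_natr (p : nat) (k n : nat) : sval (k%:R : Zpadic p) n = (k%:Z %% zp_mod p n)%Z.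
Proof.
elim: k => [|k IH]; first by [].
by rewrite -addn1 natrD [sval _ n]/= IH modzDm PoszD.
Qed.

Lemma zp_natr_neq0 (p k : nat) : (0 < k)%N -> k%:R != 0 :> Zpadic p.
Proof.
move=> k0; apply/eqP => /(congr1 (fun z : Zpadic p => sval z k)).
rewrite sval_zp_natr [RHS]/= mod0z modz_small; first by case: k k0.
by rewrite /= /zp_mod ltz_nat ltn_expl // prime_gt1 // zp_prime_prime.
Qed.

Lemma zp_sval_dvd (p : nat) (hp : prime p) (z : Zpadic p) n :
  zred z = 0 -> (p%:Z %| sval z n.+1)%Z.
Proof.
move/eqP; rewrite /zred Fp_intr_eq0 // => h.
have := zp_coh_iter z 1 n; rewrite add1n zp_mod1 // => e.
by apply/dvdz_mod0P; rewrite e -[LHS](zp_comp_mod z 1) zp_mod1 //; apply/dvdz_mod0P.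
Qed.

(** Dividing component [n + 1] of [z] by [p] gives component [n] of the quotient; this shift of
    level keeps it coherent. *)
Lemma zred_eq0 (p : nat) (hp : prime p) (z : Zpadic p) :
  zred z = 0 -> exists w : Zpadic p, z = p%:R * w.
Proof.
move=> z0; have p0 : p%:Z != 0 by rewrite -lt0n prime_gt0.
pose g n := (sval z n.+1 %/ p%:Z)%Z.
have gE n : sval z n.+1 = p%:Z * g n by rewrite mulrC /g divzK ?zp_sval_dvd.
have gh n : (g n.+1 %% zp_mod p n)%Z = (g n %% zp_mod p n)%Z.
  apply/eqP; rewrite eqz_mod_dvd -(dvdz_mul2l p0) mulrBr -!gE -zp_modS //.
  by rewrite -eqz_mod_dvd (zp_comp_succ z n.+1) zp_comp_mod.
exists (zp_mk gh); apply: zp_ext => n.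
rewrite [RHS]/= sval_zp_natr modzMml modzMmr -gE.
by rewrite zp_comp_succ.
Qed.

(** Bezout gives an inverse at each level, and uniqueness of inverses mod [p ^ n] makes them
    coherent. *)
Lemma zred_unit (p : nat) (hp : prime p) (z : Zpadic p) :
  zred z != 0 -> exists w : Zpadic p, w * z = 1.
Proof.
rewrite /zred Fp_intr_eq0 // => z0.
have co n : coprimez (sval z n) (zp_mod p n).
  case: n => [|n]; first by rewrite coprimezE coprimen1.
  rewrite coprimezE /zp_mod zp_prime_id // absz_nat coprimeXr //.
  rewrite coprime_sym prime_coprime //; apply: contra z0 => h.
  have := zp_coh_iter z 1 n; rewrite add1n zp_mod1 // => <-.
  by apply/dvdz_mod0P; rewrite modz_mod; apply/dvdz_mod0P.
pose g n := (egcdz (sval z n) (zp_mod p n)).1.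
have gE n : (zp_mod p n %| g n * sval z n - 1)%Z.
  rewrite /g; case: egcdzP (co n) => u v /= e _ /eqP c; rewrite c in e; rewrite -e.
  by rewrite opprD addrA subrr add0r rpredN dvdz_mull.
have gh n : (g n.+1 %% zp_mod p n)%Z = (g n %% zp_mod p n)%Z.
  have h1 : (zp_mod p n %| g n.+1 * sval z n.+1 - 1)%Z.
    by apply: dvdz_trans (gE n.+1); rewrite zp_modS // dvdz_mull.
  have h2 : (zp_mod p n %| sval z n.+1 - sval z n)%Z.
    by rewrite -eqz_mod_dvd zp_comp_succ zp_comp_mod.
  apply/eqP; rewrite eqz_mod_dvd.
  (* Uniqueness of the inverse as an identity: each of the three terms is divisible by [p ^ n]. *)
  have -> : g n.+1 - g n = g n * (g n.+1 * sval z n.+1 - 1)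
    - g n.+1 * (g n * sval z n - 1) - g n.+1 * g n * (sval z n.+1 - sval z n) by ring.
  by apply: rpredB; [apply: rpredB|]; apply: dvdz_mull.
exists (zp_mk gh); apply: zp_ext => n.
by rewrite [LHS]/= [RHS]/= modzMml; apply/eqP; rewrite eqz_mod_dvd.
Qed.

(** * The Teichmueller character *)

(** The cofactor of [a - b] in [a ^ p - b ^ p] has [p] summands, all congruent to [b ^ (p - 1)] mod
    [p], and so contributes another factor [p]. *)
Lemma expr_dvd_prime (p : nat) (M a b : int) : prime p -> (p%:Z %| M)%Z -> (M %| a - b)%Z ->
  (p%:Z * M %| a ^+ p - b ^+ p)%Z.
Proof.
move=> hp pM Mab; rewrite subrXX mulrC; apply: dvdz_mul => //.
have ab : (p%:Z %| a - b)%Z by exact: dvdz_trans Mab.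
rewrite -Fp_intr_eq0 // rmorph_sum /=.
have e : a%:~R = b%:~R :> 'F_p.
  by apply/eqP; rewrite -subr_eq0 -intrB Fp_intr_eq0.
rewrite (eq_bigr (fun=> (b%:~R : 'F_p) ^+ p.-1)) => [|i _].
  by rewrite sumr_const card_ord -mulr_natr mulf_eq0 Fp_natr_eq0 // dvdnn orbT.
by rewrite rmorphM !rmorphXn /= e -exprD subnK // -ltnS prednK ?prime_gt0.
Qed.

Lemma expr_pexp_dvd (p n : nat) (a b : int) : prime p -> (p%:Z %| a - b)%Z ->
  (zp_mod p n.+1 %| a ^+ (p ^ n) - b ^+ (p ^ n))%Z.
Proof.
move=> hp ab; elim: n => [|n IH]; first by rewrite zp_mod1.
rewrite zp_modS // expnSr !exprM; apply: expr_dvd_prime => //.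
by rewrite zp_modS // dvdz_mulr.
Qed.

Lemma Fp_intr_dvd (p : nat) (a b : int) : prime p -> a%:~R = b%:~R :> 'F_p ->
  (p%:Z %| a - b)%Z.
Proof. by move=> hp e; rewrite -Fp_intr_eq0 // intrB e subrr. Qed.

Lemma expr_pexp_mod (p n : nat) (a b : int) : prime p -> a%:~R = b%:~R :> 'F_p ->
  (a ^+ (p ^ n) %% zp_mod p n)%Z = (b ^+ (p ^ n) %% zp_mod p n)%Z.
Proof.
move=> hp e; apply/eqP; rewrite eqz_mod_dvd; apply: dvdz_trans (expr_pexp_dvd _ hp (Fp_intr_dvd hp e)).
by rewrite zp_modS // dvdz_mull.
Qed.

Lemma Fp_val_intr (p : nat) (y : 'F_p) : (y : nat)%:Z%:~R = y.
Proof. exact: natr_Zp. Qed.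

Lemma teichmuller_coherent (p : nat) (hp : prime p) (y : 'F_p) n :
  (((y : nat)%:Z ^+ (p ^ n.+1)) %% zp_mod p n)%Z = (((y : nat)%:Z ^+ (p ^ n)) %% zp_mod p n)%Z.
Proof.
rewrite expnS exprM; apply: expr_pexp_mod => //.
by rewrite rmorphXn /= Fp_val_intr; have := expf_card y; rewrite card_Fp.
Qed.

(** This is the limit of [y ^ (p ^ n)], whose coherence rests on [y ^ p = y] in ['F_p]. *)
Definition teichmuller (p : nat) (hp : prime p) : pchar p :=
  [ffun y : 'F_p => zp_mk (teichmuller_coherent hp y)].

Lemma zred_teichmuller (p : nat) (hp : prime p) (y : 'F_p) : zred (teichmuller hp y) = y.
Proof.
rewrite ffunE /zred [sval _ 1%N]/= zp_mod1 // Fp_intr_mod // expn1 rmorphXn /= Fp_val_intr.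
by have := expf_card y; rewrite card_Fp.
Qed.

(** The integer representative of [a * b] matches the product of representatives only mod [p];
    taking [p ^ n]-th powers lifts this to mod [p ^ n]. *)
Lemma teichmuller_character (p : nat) (hp : prime p) : is_character (teichmuller hp).
Proof.
split=> [||a b]; rewrite !ffunE; apply: zp_ext => n.
- by rewrite [LHS]/= expr0n gtn_eqF // expn_gt0 prime_gt0.
- rewrite [LHS]/= [RHS]/= -[X in _ = (X %% _)%Z](expr1n _ (p ^ n)).
  by apply: expr_pexp_mod; rewrite // Fp_val_intr.
- rewrite [RHS]/= modzMm -exprMn.
  by apply: expr_pexp_mod; rewrite // intrM !Fp_val_intr.
Qed.

(** * Reduction of integral elements of the [p]-adic field *)

(** A relation, since reduction is defined only on the integral elements of [Qpadic p]. Congruence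
    follows once both sides have the same residue. *)
Definition qred (p : nat) (a : Qpadic p) (r : 'F_p) : Prop :=
  exists2 z : Zpadic p, a = zp_to_qp z & zred z = r.

Lemma qred_zp (p : nat) (z : Zpadic p) (r : 'F_p) : zred z = r -> qred (zp_to_qp z) r.
Proof. by exists z. Qed.

Lemma qred0 (p : nat) : qred (0 : Qpadic p) 0.
Proof. by exists 0; rewrite ?zred0 // /zp_to_qp tofrac0. Qed.

Lemma qred1 (p : nat) (hp : prime p) : qred (1 : Qpadic p) 1.
Proof. by exists 1; rewrite ?zred1 // /zp_to_qp tofrac1. Qed.

Lemma qredD (p : nat) (hp : prime p) (a b : Qpadic p) r s :
  qred a r -> qred b s -> qred (a + b) (r + s).
Proof.
by move=> [z -> <-] [w -> <-]; exists (z + w); rewrite ?zredD // /zp_to_qp tofracD.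
Qed.

Lemma qredN (p : nat) (hp : prime p) (a : Qpadic p) r : qred a r -> qred (- a) (- r).
Proof. by move=> [z -> <-]; exists (- z); rewrite ?zredN // /zp_to_qp tofracN. Qed.

Lemma qredM (p : nat) (hp : prime p) (a b : Qpadic p) r s :
  qred a r -> qred b s -> qred (a * b) (r * s).
Proof.
by move=> [z -> <-] [w -> <-]; exists (z * w); rewrite ?zredM // /zp_to_qp tofracM.
Qed.

Lemma qredV (p : nat) (hp : prime p) (a : Qpadic p) r :
  r != 0 -> qred a r -> qred a^-1 r^-1.
Proof.
move=> r0 [z -> zr]; rewrite -zr in r0.
have [w wz] := zred_unit hp r0; exists w.
  apply: (@mulIf _ (zp_to_qp z)).
    by rewrite /zp_to_qp tofrac_eq0; apply: contraNneq r0 => ->; rewrite zred0.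
  rewrite mulVf; last by rewrite /zp_to_qp tofrac_eq0; apply: contraNneq r0 => ->; rewrite zred0.
  by rewrite /zp_to_qp -tofracM wz tofrac1.
by apply: (mulIf r0); rewrite -zr mulVf // -zredM // wz zred1.
Qed.

Lemma qredX (p : nat) (hp : prime p) (a : Qpadic p) r n : qred a r -> qred (a ^+ n) (r ^+ n).
Proof.
by move=> h; elim: n => [|n IH]; [exact: qred1 | rewrite !exprS; exact: qredM].
Qed.

Lemma qred_natr (p : nat) (hp : prime p) n : qred (n%:R : Qpadic p) n%:R.
Proof.
elim: n => [|n IH]; first exact: qred0.
by rewrite -!natr1; apply: qredD => //; exact: qred1.
Qed.

Lemma qred_intr (p : nat) (hp : prime p) (n : int) : qred (n%:~R : Qpadic p) n%:~R.
Proof.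
by case: n => n; rewrite ?NegzE ?mulrNz; [|apply: qredN => //]; exact: qred_natr.
Qed.

Lemma qred_sum (p : nat) (hp : prime p) (I : Type) (s : seq I) (P : pred I)
    (F : I -> Qpadic p) (G : I -> 'F_p) :
  (forall i, P i -> qred (F i) (G i)) -> qred (\sum_(i <- s | P i) F i) (\sum_(i <- s | P i) G i).
Proof.
by move=> h; apply: (big_ind2 (@qred p)) => // [|a r b t]; [exact: qred0 | exact: qredD].
Qed.

Lemma qred_prod (p : nat) (hp : prime p) (I : Type) (s : seq I) (P : pred I)
    (F : I -> Qpadic p) (G : I -> 'F_p) :
  (forall i, P i -> qred (F i) (G i)) -> qred (\prod_(i <- s | P i) F i) (\prod_(i <- s | P i) G i).
Proof.
by move=> h; apply: (big_ind2 (@qred p)) => // [|a r b t]; [exact: qred1 | exact: qredM].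
Qed.

Lemma qred_poch (p : nat) (hp : prime p) (a : Qpadic p) r k :
  qred a r -> qred (poch a k) (poch r k).
Proof.
by move=> h; apply: qred_prod => // i _; apply: qredD => //; exact: qred_natr.
Qed.

Lemma qred_congp (p : nat) (hp : prime p) (a b : Qpadic p) r :
  qred a r -> qred b r -> congp a b.
Proof.
move=> [z -> zr] [w -> wr].
have [|v e] := @zred_eq0 p hp (z - w); first by rewrite zredD // zredN // zr wr subrr.
by exists v; rewrite /zp_to_qp -tofracB e tofracM tofracMn tofrac1.
Qed.

Lemma qp_natr_neq0 (p k : nat) : (0 < k)%N -> k%:R != 0 :> Qpadic p.
Proof.
by move=> k0; rewrite -[1]tofrac1 -tofracMn tofrac_eq0 zp_natr_neq0.
Qed.

(** * The group of characters *)

Lemma char_pow_character (p : nat) (T : pchar p) k :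
  is_character T -> is_character (char_pow T k).
Proof.
case=> T0 T1 TM; split=> [||a b]; rewrite !ffunE ?eqxx ?oner_eq0 ?T1 ?expr1n // mulf_eq0.
by case: eqP; case: eqP; rewrite ?mul0r ?mulr0 // TM exprMn.
Qed.

Lemma character_exp (p : nat) (T : pchar p) (y : 'F_p) n :
  is_character T -> T (y ^+ n) = T y ^+ n.
Proof.
by case=> T0 T1 TM; elim: n => [|n IH]; rewrite ?expr0 // !exprS TM IH.
Qed.

Lemma character_exp_pred (p : nat) (hp : prime p) (T : pchar p) (y : 'F_p) :
  is_character T -> y != 0 -> T y ^+ p.-1 = 1.
Proof. by move=> hT y0; rewrite -character_exp // Fp_expf_pred //; case: hT. Qed.

(* Since [teichmuller = T^k], reduction mod [p] forces [k] to be prime to [p - 1]. *)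
Lemma char_generator_teichmuller (p : nat) (hp : prime p) (T : pchar p) :
  odd p -> is_char_generator T ->
  exists2 m, coprime m p.-1 & T = char_pow (teichmuller hp) m.
Proof.
move=> op [hT /(_ _ (teichmuller_character hp))[k ek]].
have p2 : (2 < p)%N by exact: odd_prime_gt2.
have ev (y : 'F_p) : y != 0 -> teichmuller hp y = T y ^+ k.
  by move=> y0; rewrite ek ffunE (negbTE y0).
have co : coprime k p.-1.
  set g := gcdn k p.-1; have g0 : (0 < g)%N by rewrite gcdn_gt0; lia.
  have eg : (p.-1 %/ g * g = p.-1)%N by rewrite divnK ?dvdn_gcdr.
  case: (ltnP 1 g) => g1; last by rewrite /coprime -/g; apply/eqP; lia.
  (* Mod [p], [y ^ ((p-1)/g)] is [T y ^ ((p-1)(k/g)) = 1] for every unit [y], impossible for a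
     positive exponent below [p - 1]. *)
  suff: (p.-1 %/ g = 0)%N by move=> e; move: eg; rewrite e; lia.
  apply: (@Fp_expr_inj p) => //; [by rewrite ltn_Pdiv; lia | by lia|] => y y0.
  rewrite expr0 -[X in X ^+ _](zred_teichmuller hp) -zredX // ev // -exprM.
  have -> : (k * (p.-1 %/ g) = p.-1 * (k %/ g))%N.
    by rewrite -{1}(divnK (dvdn_gcdl k p.-1)) -/g -{2}eg; lia.
  by rewrite exprM character_exp_pred // expr1n zred1.
have k0 : (0 < k)%N by rewrite lt0n; apply: contraTneq co => ->; rewrite /coprime gcd0n; lia.
(* Here [m] inverts [k] mod [p - 1], so that [T = T^(km)] is the [m]-th power of [teichmuller]. *)
have [[m u] /= e] := coprimeP _ k0 co.
have e' : (k * m = 1 + p.-1 * u)%N by lia.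
exists m.
  have m0 : (0 < m)%N by rewrite lt0n; apply/eqP => m0; move: e'; rewrite m0 muln0; lia.
  by apply/(coprimeP _ m0); exists (k, u); rewrite /=; lia.
apply/ffunP => y; rewrite ffunE; case: eqP => [->|/eqP y0]; first by case: hT.
by rewrite ev // -exprM e' exprD exprM character_exp_pred // expr1n mulr1.
Qed.

Lemma char_pow_teichmuller_mod (p : nat) (hp : prime p) k :
  char_pow (teichmuller hp) k = char_pow (teichmuller hp) (k %% p.-1).
Proof.
apply/ffunP => y; rewrite !ffunE; case: eqP => // /eqP y0.
rewrite {1}(divn_eq k p.-1) mulnC exprD exprM.
have := character_exp_pred hp (teichmuller_character hp) y0; rewrite ffunE => ->.
by rewrite expr1n mul1r.
Qed.

Lemma zred_char_pow (p : nat) (hp : prime p) k (y : 'F_p) : y != 0 ->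
  zred (char_pow (teichmuller hp) k y) = y ^+ k.
Proof. by move=> y0; rewrite ffunE (negbTE y0) zredX // zred_teichmuller. Qed.

(** Distinctness is visible after reduction mod [p]; completeness holds because the generator is
    itself a power of [teichmuller]. Equality up to permutation suffices for the sum in
    [greeneF]. *)
Lemma all_chars_teichmuller (p : nat) (hp : prime p) (T : pchar p) :
  odd p -> is_char_generator T ->
  perm_eq (all_chars p) [seq char_pow (teichmuller hp) k | k <- iota 0 p.-1].
Proof.
move=> op hT; set s := [seq _ | _ <- _].
have p2 : (2 < p)%N by exact: odd_prime_gt2.
have us : uniq s.
  rewrite map_inj_in_uniq ?iota_uniq // => k l; rewrite !mem_iota /= !add0n => kp lp e.
  by apply: (@Fp_expr_inj p) => // y y0; rewrite -!(zred_char_pow hp) // e.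
have ms chi : is_character chi <-> chi \in s.
  split=> [|/mapP[k _ ->]]; last by apply: char_pow_character; exact: teichmuller_character.
  have [m _ eT] := char_generator_teichmuller hp op hT.
  case: hT => _ hT /hT[j ->]; apply/mapP; exists (m * j %% p.-1)%N.
    by rewrite mem_iota /= add0n ltn_mod; lia.
  rewrite -char_pow_teichmuller_mod eT; apply/ffunP => y.
  rewrite ffunE [RHS]ffunE; case: ifP => // y0.
  by rewrite ffunE y0 exprM.
rewrite /all_chars; case: excluded_middle_informative => [h|[]]; last by exists s.
case: constructive_indefinite_description => r /= [ur mr].
apply: uniq_perm => // chi; apply/idP/idP => [/mr/ms|/ms/mr] //.
Qed.

(** * Greene's function mod [p] *)

(** The factor [p] cancels the denominator, leaving a Jacobi sum that reduces to [Fp_jacobi_sum].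
    The value of [B] at 0 is given apart because for [k = 0] it differs from [0 ^ 0 = 1]. *)
Lemma qred_gbinom (p : nat) (hp : prime p) (A B : pchar p) s k :
  odd p -> (0 < s < p.-1)%N -> (k < p.-1)%N ->
  (forall y, zred (A y) = y ^+ (s + k)) ->
  B 0 = 0 -> (forall y, y != 0 -> zred (B y) = y ^+ k) ->
  qred (p%:R * gbinom A B) (- (poch s.+1%:R k / k`!%:R)).
Proof.
move=> op sp kp hA B0 hB.
rewrite -(Fp_jacobi_sum hp op sp kp) /gbinom.
have p0 : p%:R != 0 :> Qpadic p by rewrite qp_natr_neq0 ?prime_gt0.
rewrite mulrA mulrCA divff // mulr1; apply: qredM => //.
  by apply: qred_zp; rewrite hB // oppr_eq0 oner_eq0.
apply: qred_sum => // y _; apply: qredM => //; first by apply: qred_zp; rewrite hA.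
(* At [y = 1] the convention [0^-1 = 0] gives the inverse character its value 0, matching
   [0 ^ (p-1-k)] with positive exponent. *)
have [->|y1] := eqVneq (1 - y) 0.
  rewrite expr0n gtn_eqF ?subn_gt0 // /cval B0 /zp_to_qp tofrac0 invr0; exact: qred0.
have -> : (1 - y) ^+ (p.-1 - k) = ((1 - y) ^+ k)^-1.
  apply: (mulIf (expf_neq0 k y1)); rewrite -exprD subnK ?(ltnW kp) // Fp_expf_pred //.
  by rewrite mulVf // expf_neq0.
by apply: qredV => //; [exact: expf_neq0 | apply: qred_zp; exact: hB].
Qed.

Lemma mem_all_chars (p : nat) (chi : pchar p) : chi \in all_chars p -> is_character chi.
Proof.
rewrite /all_chars; case: excluded_middle_informative => // h.
by case: constructive_indefinite_description => s /= [_ hs] /hs.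
Qed.

Lemma char_mul_eps (p : nat) (chi : pchar p) : chi 0 = 0 -> char_mul (eps_char p) chi = chi.
Proof.
move=> chi0; apply/ffunP => y; rewrite !ffunE.
by case: eqP => [->|_]; rewrite ?mul1r // mul0r chi0.
Qed.

(** The [n] powers of [p] and the one in the prefactor of [greeneF] supply one [p] to each of the
    [n + 1] binomials. *)
Lemma greeneF_eps (p n : nat) (A : nat -> pchar p) (x : 'F_p) :
  p%:R ^+ n * greeneF n A (fun=> eps_char p) x =
  (p%:R - 1)^-1 * \sum_(chi <- all_chars p)
    \prod_(0 <= i < n.+1) (p%:R * gbinom (char_mul (A i) chi) chi) * cval chi x.
Proof.
rewrite /greeneF [p%:R / _]mulrC mulrCA -!mulrA; congr (_ * _).
rewrite !mulr_sumr !big_seq; apply: eq_bigr => chi /mem_all_chars[chi0 _ _].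
rewrite mulrA mulrA; congr (_ * _).
rewrite mulrA -exprS [RHS]big_split /= [X in _ = X * _]prodr_const_nat subn0 -mulrA.
congr (_ * _).
rewrite [RHS]big_ltn //; congr (_ * _).
by apply: eq_bigr => i _; rewrite char_mul_eps.
Qed.

(** * The truncated series and its parameters mod [p] *)

(** Truncating at [m <= p] keeps every [k!] in the denominators a unit mod [p]. *)
Lemma qred_truncF (p n m : nat) (hp : prime p) (a : nat -> Qpadic p) (a' : nat -> 'F_p)
   (x : Qpadic p) (x' : 'F_p) : (m <= p)%N ->
  (forall i, (i <= n)%N -> qred (a i) (a' i)) -> qred x x' ->
  qred (truncF n a (fun=> 1) x m) (truncF n a' (fun=> 1) x' m).
Proof.
move=> mp ha hx; apply: qred_sum => // k _.
have kp : (k < p)%N by exact: leq_trans mp.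
apply: qredM => //; last exact: qredX.
apply: qredM => //.
  rewrite 2!big_nat; apply: qred_prod => // i /andP[_ i_n]; apply: qred_poch => //.
  exact: ha.
apply: qredV => //.
  by rewrite prodr_const_nat mulf_neq0 ?expf_neq0 ?poch1 // Fp_fact_neq0.
apply: qredM => //; last exact: qred_natr.
by apply: qred_prod => // i _; apply: qred_poch => //; exact: qred1.
Qed.

Lemma coprime_mul_mod_inj (m d a b : nat) : coprime m d -> (a < d)%N -> (b < d)%N ->
  (m * a = m * b %[mod d])%N -> a = b.
Proof.
move=> co; wlog ab : a b / (b <= a)%N => [hw|] ad bd e.
  by case/orP: (leq_total b a) => h; [|symmetry]; apply: hw.
move/eqP: e; rewrite eqn_mod_dvd ?leq_mul2l ?ab ?orbT // -mulnBr Gauss_dvdr 1?coprime_sym //.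
by move/dvdn_leq; lia.
Qed.


Lemma twist_mod_gt0 (m d i : nat) : coprime m d -> (i.+1 < d)%N -> (0 < m * i.+1 %% d)%N.
Proof.
move=> co id; rewrite lt0n; apply/eqP => e.
by have := @coprime_mul_mod_inj m d i.+1 0 co id (ltn_trans (ltn0Sn i) id); rewrite muln0 mod0n e => /(_ erefl).
Qed.

(* Multiplication by [m] permutes the nonzero residues mod [n + 2], and so does negation. *)
Lemma prod_twist (F : fieldType) (m n : nat) (f : nat -> F) : coprime m n.+2 ->
  \prod_(0 <= i < n.+1) f (n.+1 - m * i.+1 %% n.+2)%N = \prod_(0 <= i < n.+1) f i.
Proof.
move=> co; rewrite !big_mkord.
(* Index [i] stands for the residue [i + 1], so the negative [n + 2 - r] of a residue [r] has index
   [n + 1 - r]. *)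
pose h (i : 'I_n.+1) : 'I_n.+1 := inord (n.+1 - m * i.+1 %% n.+2).
have e0 (i : 'I_n.+1) : (0 < m * i.+1 %% n.+2)%N by rewrite twist_mod_gt0 // ltnS.
have eh (i : 'I_n.+1) : h i = (n.+1 - m * i.+1 %% n.+2)%N :> nat.
  by rewrite inordK //; have := e0 i; lia.
have hi : injective h.
  move=> i j /(congr1 (@nat_of_ord _)); rewrite !eh => e.
  have li : (m * i.+1 %% n.+2 <= n.+1)%N by rewrite -ltnS ltn_mod.
  have lj : (m * j.+1 %% n.+2 <= n.+1)%N by rewrite -ltnS ltn_mod.
  suff [/val_inj] : i.+1 = j.+1 by [].
  apply: (coprime_mul_mod_inj co); [exact: (ltn_ord i) | exact: (ltn_ord j) |].
    by apply/eqP; rewrite -(eqn_sub2lE li lj) e.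
by rewrite [RHS](reindex_inj hi); apply: eq_bigr => i _; rewrite eh.
Qed.

Lemma mul_eq_pred_bounds (t d p : nat) : (1 < p)%N -> (t * d = p.-1)%N ->
  (0 < t)%N /\ (d < p)%N.
Proof.
move=> p1 td; have t0 : (0 < t)%N by case: t td => //; lia.
by split=> //; have := leq_pmull d t0; lia.
Qed.

(** In the term [k = p - 1], the symbol of [1/d] contains the factor [1/d + t = (1 + td)/d = 0]. The
    remaining terms match the [p - 1] characters. *)
Lemma Fp_truncF_pred (p n t : nat) (hp : prime p) (x : 'F_p) :
  (t * n.+2 = p.-1)%N ->
  truncF n (fun i => i.+1%:R / n.+2%:R) (fun=> 1) x p =
  truncF n (fun i => i.+1%:R / n.+2%:R) (fun=> 1) x p.-1 :> 'F_p.
Proof.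
move=> td; have p1 := prime_gt1 hp.
transitivity (truncF n (fun i => i.+1%:R / n.+2%:R) (fun=> 1) x p.-1.+1 : 'F_p).
  by rewrite prednK ?prime_gt0.
rewrite /truncF big_ord_recr /=.
have [t0 dp] := mul_eq_pred_bounds p1 td.
have d0 : n.+2%:R != 0 :> 'F_p by rewrite Fp_natr_neq0.
suff p0 : poch (1%:R / n.+2%:R : 'F_p) p.-1 = 0 by rewrite big_ltn // p0 !mul0r addr0.
have tp : (t < p.-1)%N by rewrite -td ltn_Pmulr.
rewrite /poch (bigD1 (Ordinal tp)) //=.
suff -> : 1%:R / n.+2%:R + t%:R = 0 :> 'F_p by rewrite mul0r.
apply: (mulIf d0); rewrite mul0r mulrDl divfK // -natrM td Fp_pred_natr //.
by rewrite subrr.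
Qed.

(** * Comparison of the two sides in ['F_p] *)

Unset Implicit Arguments.

Theorem theorem3p3 (d p : nat) (hd : (2 <= d)%N) (hp : prime p)
  (hpd : p = 1 %[mod d]) (T : pchar p) (hT : is_char_generator T)
  (x : int) (hx : ~~ (p%:Z %| x)%Z) :
  let t := ((p - 1) %/ d)%N in
  congp
    ((p%:R : Qpadic p) ^+ (d - 2) *
       greeneF (d - 2) (fun i => char_pow T (i.+1 * t)) (fun _ => eps_char p) (x%:~R))
    ((-1) ^+ d *
       truncF (d - 2) (fun i => (i.+1)%:R / d%:R) (fun _ => 1) (x%:~R) p).
Proof.
move=> t.
have p1 := prime_gt1 hp.
have td : (t * d = p.-1)%N.
  rewrite /t divnK ?subn1 //.
  by move/eqP: hpd; rewrite eqn_mod_dvd ?subn1 // ltnW.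
clearbody t.
case: d hd hpd td => [|[|n]] // _ _ td; rewrite !subSS subn0.
have [t0 dp] := mul_eq_pred_bounds p1 td.
have op : odd p by have [p2|//] := even_prime hp; move: dp; rewrite p2.
have d0 : n.+2%:R != 0 :> 'F_p by rewrite Fp_natr_neq0.
set xb : 'F_p := x%:~R.
have xb0 : xb != 0 by rewrite Fp_intr_eq0.
set a := fun i : nat => i.+1%:R / n.+2%:R : 'F_p.
have hR : qred ((-1) ^+ n.+2 * truncF n (fun i => i.+1%:R / n.+2%:R) (fun=> 1) x%:~R p : Qpadic p)
    ((-1) ^+ n.+2 * truncF n a (fun=> 1) xb p).
  apply: qredM => //; first by apply: qredX => //; apply: qredN => //; exact: qred1.
  apply: qred_truncF => // [i _|]; last exact: qred_intr.
  by apply: qredM => //; [|apply: qredV => //]; exact: qred_natr.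
apply: qred_congp hR => //; rewrite greeneF_eps.
have [m com eT] := char_generator_teichmuller hp op hT.
have cod : coprime m n.+2 by apply: coprime_dvdr com; rewrite -td dvdn_mull.
rewrite (perm_big _ (all_chars_teichmuller hp op hT)) big_map /=.
(* Since [t * d = p - 1], the character [T^((i+1)t)] depends only on [m (i+1)] mod [d]. *)
pose e i := (m * i.+1 %% n.+2)%N.
have tt : t%:R * n.+2%:R = -1 :> 'F_p by rewrite -natrM td Fp_pred_natr.
(* Of the [n + 2] signs, one is the residue of [1/(p-1)] and each of the [n + 1] binomials takes
   one. *)
have -> : (-1) ^+ n.+2 * truncF n a (fun=> 1) xb p = (-1)^-1 * \sum_(k <- iota 0 p.-1)
    \prod_(0 <= i < n.+1) - (poch (e i * t).+1%:R k / k`!%:R) * xb ^+ k.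
  rewrite invrN1 /a (Fp_truncF_pred hp xb td) exprS -mulrA; congr (_ * _).
  rewrite /truncF.
  have -> : iota 0 p.-1 = index_iota 0 p.-1 by rewrite /index_iota subn0.
  rewrite big_mkord mulr_sumr; apply: eq_bigr => k _; rewrite mulrA; congr (_ * _).
  rewrite -(prod_twist (fun i => poch (i.+1%:R / n.+2%:R : 'F_p) k) cod).
  rewrite prodr_const_nat poch1 -exprSr subn1 /=.
  transitivity (\prod_(0 <= i < n.+1) (-1 * (poch (a (n.+1 - e i)%N) k / k`!%:R))).
    rewrite 2!big_split /= !prodr_const_nat subn0 exprVn; congr (_ * (_ * _)).
  rewrite !big_nat; apply: eq_bigr => i /andP[_ i_n]; rewrite mulN1r.
  (* After multiplication by [d], the claim is [d - e = (et + 1) d], that is [td = -1]. *)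
  congr (- (poch _ _ / _)); apply: (mulIf d0); rewrite /a divfK //.
  have ei : (e i < n.+2)%N by rewrite ltn_mod.
  rewrite -subSn // natrB ?(ltnW ei) // -[in RHS]natr1 mulrDl natrM -mulrA tt mulrN1 mul1r.
  by rewrite addrC.
apply: qredM => //.
  apply: qredV => //; first by rewrite oppr_eq0 oner_eq0.
  have -> : -1 = p%:R - 1 :> 'F_p by rewrite pchar_Fp_0 // sub0r.
  by apply: qredD => //; [exact: qred_natr | apply: qredN => //; exact: qred1].
rewrite !big_seq; apply: qred_sum => // k; rewrite mem_iota /= add0n => kp.
apply: qredM => //; last by apply: qred_zp; rewrite zred_char_pow.
rewrite 2!big_nat; apply: qred_prod => // i /andP[_ i_n].
have ei : (e i < n.+2)%N by rewrite ltn_mod.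
have ei0 : (0 < e i)%N by apply: twist_mod_gt0.
apply: qred_gbinom => // [|y||y y0]; last by rewrite zred_char_pow.
- by rewrite muln_gt0 ei0 t0 -td mulnC ltn_pmul2l.
- rewrite ffunE zredM // eT; have [->|y0] := eqVneq y 0.
    by rewrite [X in zred X]ffunE eqxx zred0 mul0r expr0n gtn_eqF // addn_gt0 muln_gt0 ei0 t0.
  rewrite zred_char_pow // ffunE (negbTE y0) zredX // zred_char_pow // -exprM exprD.
  congr (_ * _).
  (* The quotient of [m (i+1)] by [d] contributes a multiple of [p - 1], which Fermat removes. *)
  have -> : (m * (i.+1 * t) = p.-1 * (m * i.+1 %/ n.+2) + e i * t)%N.
    by rewrite mulnA {1}(divn_eq (m * i.+1) n.+2) -/(e i) -td; ring.
  by rewrite exprD exprM Fp_expf_pred // expr1n mul1r.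
- by rewrite ffunE eqxx.
Qed.
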